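(* Let $\alpha<5/4$. There is no constant $C$ such that $$\left(\int |v|^4\,r^{4\alpha-1}\,dr\,dz\right)^{1/4}\le C\left(\int|\nabla v|^2\,r^3\,dr\,dz\right)^{1/2}$$ for all compactly supported smooth functions $v$ near the axis. In particular, this inequality cannot hold scale-independently for $3/4<\alpha<1$.
   Context: Functions $v=v(r,z)$ are defined on the meridional half-plane $\{(r,z): r>0,\ z\in\mathbb R\}$, the axis is $\{r=0\}$, and $\nabla=(\partial_r,\partial_z)$. ''Compactly supported smooth $v$ near the axis'' means $v\in C_c^\infty((0,\delta)\times(-\delta,\delta))$ for a fixed $\delta>0$; the nonexistence of $C$ is asserted for every such $\delta$. *)

(* Defs.v *)
From HB Require Import structures.
From mathcomp Require Import all_boot all_order all_algebra.
From mathcomp Require Import all_classical all_reals all_analysis.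
Set Implicit Arguments.
Unset Strict Implicit.
Unset Printing Implicit Defensive.
Import Order.TTheory GRing.Theory Num.Theory.
Import numFieldNormedType.Exports.
Local Open Scope classical_set_scope.
Local Open Scope ring_scope.

(* A point p : R * R of the (r, z)-plane has r = p.1 and z = p.2. *)

Definition dr (R : realType) (v : R * R -> R) : R * R -> R :=
  fun p => 'D_((1, 0) : R * R) v p.

Definition dz (R : realType) (v : R * R -> R) : R * R -> R :=
  fun p => 'D_((0, 1) : R * R) v p.

(* 'D_w is a total operator, so derivability is required separately. *)
Fixpoint Ck (R : realType) (k : nat) (v : R * R -> R) : Prop :=
  match k with
  | 0%N => continuous v
  | k'.+1 => [/\ continuous v,
                 forall p, derivable v p ((1, 0) : R * R),
                 forall p, derivable v p ((0, 1) : R * R),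
                 Ck k' (dr v) & Ck k' (dz v)]
  end.

Definition smooth (R : realType) (v : R * R -> R) : Prop :=
  forall k : nat, Ck k v.

Definition supp (R : realType) (v : R * R -> R) : set (R * R) :=
  closure [set p | v p != 0].

(* C_c^oo(U) for U open; its elements are identified with their extensions by
   zero, which are smooth on the whole plane. *)
Definition test_function (R : realType) (U : set (R * R)) (v : R * R -> R)
    : Prop :=
  [/\ smooth v, compact (supp v) & supp v `<=` U].

Definition axis_box (R : realType) (delta : R) : set (R * R) :=
  `]0, delta[%classic `*` `](- delta), delta[%classic.

Definition half_plane (R : realType) : set (R * R) := [set p | 0 < p.1].

Definition weighted_L4 (R : realType) (alpha : R) (v : R * R -> R) : \bar R :=
  ((\int[@lebesgue_measure R \x @lebesgue_measure R]_(p in @half_plane R)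
      (`|v p| ^+ 4 * (p.1 : R) `^ (4 * alpha - 1))%:E) `^ (4^-1))%E.

Definition weighted_grad_L2 (R : realType) (v : R * R -> R) : \bar R :=
  ((\int[@lebesgue_measure R \x @lebesgue_measure R]_(p in @half_plane R)
      ((dr v p ^+ 2 + dz v p ^+ 2) * (p.1 : R) ^+ 3)%:E) `^ (2^-1))%E.

Definition weighted_ineq (R : realType) (alpha C : R) (v : R * R -> R) : Prop :=
  (weighted_L4 alpha v <= C%:E * weighted_grad_L2 v)%E.

(* Main.v *)
Require Import Defs.
From mathcomp Require Import all_boot all_order all_algebra.
From mathcomp Require Import all_classical all_reals all_analysis.
From mathcomp Require Import measurable_realfun ring lra.
Set Implicit Arguments.
Unset Strict Implicit.
Unset Printing Implicit Defensive.
Import Order.TTheory GRing.Theory Num.Theory.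
Import numFieldNormedType.Exports.
Local Open Scope classical_set_scope.
Local Open Scope ring_scope.

(** Scaling argument.  Fix a bump [u] with support in [[1, 2]] and put
    [v_l (r, z) = u (l r) * u (l z)], supported in the square [[1/l, 2/l]^2],
    which lies in the box for [l] large.  There [r ~ 1/l], so that
    [\int |v_l|^4 r^(4 alpha - 1) >= A l^-(4 alpha + 1)], whereas
    [\int |grad v_l|^2 r^3 <= B l^-3].  The inequality would thus bound
    [l^(5 - 4 alpha)], which is impossible since [5 - 4 alpha > 0]. *)

(** * Smooth functions of the form [P(1/x) exp(-1/x)], extended by zero to [x <= 0] *)

Section Flat.
Variable R : realType.
Implicit Types (P : {poly R}) (x y : R).

(** For [y >= 0], the term [y ^+ n / n!] of the exponential series is at most its sum. *)
Lemma exprn_le_expR n y : 0 <= y -> y ^+ n <= n`!%:R * expR y.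
Proof.
move=> y0; case: n => [|n].
  by rewrite expr0 fact0 mul1r -expR0 ler_expR.
rewrite mulrC -ler_pdivrMr ?ltr0n ?fact_gt0//.
by apply: le_trans (expR_ge1Dxn n y0); rewrite lerDr.
Qed.

Lemma horner_le_expR P :
  exists2 K, 0 <= K & forall y, 0 <= y -> `|P.[y]| <= K * expR y.
Proof.
exists (\sum_(i < size P) `|P`_i| * i`!%:R).
  by apply: sumr_ge0 => i _; rewrite mulr_ge0.
move=> y y0; rewrite horner_coef mulr_suml.
apply: le_trans (ler_norm_sum _ _ _) _; apply: ler_sum => i _.
rewrite normrM -mulrA ler_wpM2l// ger0_norm ?exprn_ge0//.
exact: exprn_le_expR.
Qed.

(* At x = 0 the difference quotient of [flat P] is [flat (P * 'X)], which
   vanishes there continuously; hence this family is closed under derivation. *)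
Definition flat P x : R := if 0 < x then P.[x^-1] * expR (- x^-1) else 0.

Lemma flat_le0 P x : x <= 0 -> flat P x = 0.
Proof. by move=> x0; rewrite /flat ltNge x0. Qed.

(** Multiplying [P] by ['X] inserts a factor [1/x]. Bounding the other factor gives continuity at 0,
    and dividing by [x] gives the difference quotient there. *)
Lemma flatMX P x : flat P x = flat (P * 'X) x * x.
Proof.
rewrite /flat; case: ifPn => x0; last by rewrite mul0r.
by rewrite hornerMX -!mulrA; congr (_ * _); rewrite mulrCA mulVf ?mulr1 ?gt_eqF.
Qed.

(** With [y = 1/x], the exponential dominates the polynomial on the whole half-line [y >= 0], not
    only near infinity. *)
Lemma flat_bound P : exists2 K, 0 <= K & forall x, `|flat P x| <= K.
Proof.
have [K K0 PK] := horner_le_expR P; exists K => // x; rewrite /flat.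
case: ifPn => x0; last by rewrite normr0.
rewrite normrM (ger0_norm (expR_ge0 _)) expRN ler_pdivrMr ?expR_gt0//.
by apply: PK; rewrite invr_ge0 ltW.
Qed.

Lemma flat_continuous0 P : {for 0, continuous (flat P)}.
Proof.
have [K K0 PK] := flat_bound (P * 'X).
apply/cvgrPdist_le => e e0; near=> x.
rewrite flat_le0// sub0r normrN flatMX normrM.
(* [K] may be 0, so [K + 1] serves as a positive divisor. *)
have : `|x| <= e / (K + 1).
  near: x; apply/nbhs_ballP; exists (e / (K + 1)) => /=.
    by rewrite divr_gt0// ltr_wpDl.
  by move=> y; rewrite /ball/= sub0r normrN => /ltW.
rewrite ler_pdivlMr ?ltr_wpDl//; apply: le_trans; rewrite mulrC.
by rewrite ler_wpM2l// (le_trans (PK x))// lerDl.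
Unshelve. all: by end_near. Qed.

(** For [x > 0] and [y = 1/x], [dy/dx = - y^2], so the derivative of [P(y) exp(-y)] is
    [(P - P')(y) y^2 exp(-y)]. The function is locally zero for [x < 0], and Caratheodory's
    criterion settles [x = 0]. *)
Lemma is_derive_flat P x :
  is_derive x (1 : R) (flat P) (flat ((P - P^`()) * 'X ^+ 2) x).
Proof.
have [x0|x0|->] := ltgtP x 0.
- rewrite flat_le0 ?ltW//.
  apply: (@near_eq_is_derive _ _ _ (cst 0)).
  by near=> y; rewrite flat_le0// ltW//; near: y; exact: lt_nbhsl.
- pose f y := P.[y^-1] * expR (- y^-1).
  apply: (@near_eq_is_derive _ _ _ f).
    by near=> y; rewrite /flat ifT//; near: y; exact: lt_nbhsr.
  rewrite /flat x0.
  have x1 : x != 0 by rewrite gt_eqF.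
  have dV : is_derive x (1 : R) (fun y : R => y^-1) (- x ^- 2).
    have := @is_deriveV R id x 1 1 x1 _.
    by rewrite /GRing.scale/= mulr1; apply; exact: is_derive_id.
  have dE : is_derive x (1 : R) (fun y : R => expR (- y^-1))
      (expR (- x^-1) * x ^- 2).
    apply: (@is_derive1_comp _ expR (fun y => - y^-1)).
    by rewrite -[x ^- 2]opprK; exact: is_deriveN.
  have dP : is_derive x (1 : R) (fun y : R => P.[y^-1])
      (P^`().[x^-1] * (- x ^- 2)).
    exact: (@is_derive1_comp _ (horner P) (fun y => y^-1)).
  have := is_deriveM dP dE.
  rewrite /GRing.scale/= => d; apply: is_derive_eq d _.
  by rewrite hornerM hornerXn hornerD hornerN exprVn; ring.
- rewrite flat_le0//; apply/is_derive1_caratheodory.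
  exists (flat (P * 'X)); split.
  + by move=> z; rewrite (@flat_le0 _ 0)// !subr0; exact: flatMX.
  + exact: flat_continuous0.
  + by rewrite flat_le0.
Unshelve. all: by end_near. Qed.

End Flat.

(** * Functions of class C^k in one variable *)

Section OneVariable.
Variable R : realType.
Implicit Types f g : R -> R.

(** The derivative is an existential witness, so closure properties follow by exhibiting explicit
    formulas. *)
Fixpoint Ck1 (k : nat) f : Prop :=
  match k with
  | 0%N => continuous f
  | k'.+1 => exists2 g, (forall x, is_derive x (1 : R) f (g x)) & Ck1 k' g
  end.

Lemma Ck1_continuous k f : Ck1 k f -> continuous f.
Proof.
case: k => // k [g fg _] x.
by apply/differentiable_continuous/derivable1_diffP; have [] := fg x.
Qed.

Lemma Ck1W k f : Ck1 k.+1 f -> Ck1 k f.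
Proof.
elim: k f => [|k IH] f; first exact: Ck1_continuous.
by move=> [g fg /IH ?]; exists g.
Qed.

Lemma Ck1_cst k (c : R) : Ck1 k (cst c).
Proof.
elim: k c => [|k IH] c; first by move=> x; exact: cst_continuous.
by exists (cst 0) => // x; exact: is_derive_cst.
Qed.

Lemma Ck1D k f g : Ck1 k f -> Ck1 k g -> Ck1 k (fun x => f x + g x).
Proof.
elim: k f g => [|k IH] f g /=.
  by move=> cf cg x; apply: cvgD; [exact: cf|exact: cg].
move=> [f' ff' cf] [g' gg' cg]; exists (fun x => f' x + g' x); last exact: IH.
by move=> x; exact: is_deriveD.
Qed.

Lemma Ck1M k f g : Ck1 k f -> Ck1 k g -> Ck1 k (fun x => f x * g x).
Proof.
elim: k f g => [|k IH] f g.
  by move=> cf cg x; apply: cvgM; [exact: cf|exact: cg].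
move=> cf cg; have [f' ff' cf'] := cf; have [g' gg' cg'] := cg.
(* The product rule mixes derivatives of class C^k with functions of class C^(k+1), which [Ck1W]
   lowers to C^k for the induction. *)
exists (fun x => f x * g' x + g x * f' x); last first.
  by apply: Ck1D; apply: IH => //; exact: Ck1W.
by move=> x; exact: is_deriveM.
Qed.

Lemma is_derive_affine (a b x : R) :
  is_derive x (1 : R) (fun x => a * x + b) a.
Proof.
have d1 : is_derive x (1 : R) (fun x : R => a * x) (a *: 1).
  by apply: is_deriveZ; exact: is_derive_id.
have := is_deriveD d1 (is_derive_cst b x 1).
by rewrite addr0 /GRing.scale/= mulr1.
Qed.

Lemma Ck1_affine k f (a b : R) : Ck1 k f -> Ck1 k (fun x => f (a * x + b)).
Proof.
elim: k f => [|k IH] f /=.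
  move=> cf x; apply: (@continuous_comp _ _ _ (fun x => a * x + b) f);
    last exact: cf.
  by apply: cvgD; [apply: cvgMr; exact: cvg_id|exact: cvg_cst].
move=> [f' ff' cf']; exists (fun x => f' (a * x + b) * a); last first.
  by apply: Ck1M; [exact: IH|exact: Ck1_cst].
move=> x; apply: (@is_derive1_comp _ f (fun x => a * x + b)).
exact: is_derive_affine.
Qed.

(** The derivative is again [flat] of a polynomial, so the induction on [k] runs over all [P] at
    once. *)
Lemma Ck1_flat k (P : {poly R}) : Ck1 k (flat P).
Proof.
elim: k P => [|k IH] P; last first.
  by exists (flat ((P - P^`()) * 'X ^+ 2)) => // x; exact: is_derive_flat.
move=> x; apply/differentiable_continuous/derivable1_diffP.
by have [] := is_derive_flat P x.
Qed.

End OneVariable.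

(** * Partial derivatives and smoothness of [F(r) G(z)] *)

Section TensorProduct.
Variable R : realType.
Implicit Types (F G : R -> R) (p : R * R).

(** A step along [(1, 0)] fixes the second coordinate, so the difference quotient is that of [F]
    times the constant [G p.2]. *)
Lemma is_derive_tensor1 F G p (d : R) : is_derive p.1 (1 : R) F d ->
  is_derive p ((1, 0) : R * R) (fun q => F q.1 * G q.2) (d * G p.2).
Proof.
case=> Fp dE.
have cv : (h^-1 *: ((F \o shift p.1) (h *: (1 : R)) - F p.1)) * G p.2
    @[h --> (0 : R)^'] --> d * G p.2.
  by apply: cvgMl; rewrite -dE; exact: Fp.
set q := fun h : R => _ in cv.
have qE : (fun h => h^-1 *: (((fun q => F q.1 * G q.2) \o shift p)
    (h *: ((1, 0) : R * R)) - F p.1 * G p.2)) = q.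
  apply/funext => h; rewrite /q /= /GRing.scale/= mulr0 add0r.
  by rewrite -mulrBl mulrA.
split; first by rewrite /derivable qE; apply/cvg_ex; exists (d * G p.2).
by rewrite /derive qE; exact: cvg_lim.
Qed.

Lemma is_derive_tensor2 F G p (d : R) : is_derive p.2 (1 : R) G d ->
  is_derive p ((0, 1) : R * R) (fun q => F q.1 * G q.2) (F p.1 * d).
Proof.
case=> Gp dE.
have cv : F p.1 * (h^-1 *: ((G \o shift p.2) (h *: (1 : R)) - G p.2))
    @[h --> (0 : R)^'] --> F p.1 * d.
  by apply: cvgMr; rewrite -dE; exact: Gp.
set q := fun h : R => _ in cv.
have qE : (fun h => h^-1 *: (((fun q => F q.1 * G q.2) \o shift p)
    (h *: ((0, 1) : R * R)) - F p.1 * G p.2)) = q.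
  apply/funext => h; rewrite /q /= /GRing.scale/= mulr0 add0r.
  by rewrite -mulrBr mulrCA.
split; first by rewrite /derivable qE; apply/cvg_ex; exists (F p.1 * d).
by rewrite /derive qE; exact: cvg_lim.
Qed.

Lemma dr_tensor F F' G : (forall x, is_derive x (1 : R) F (F' x)) ->
  dr (fun q => F q.1 * G q.2) = (fun q => F' q.1 * G q.2).
Proof.
move=> dF; apply/funext => p; rewrite /dr.
by have [] := @is_derive_tensor1 F G p _ (dF p.1).
Qed.

Lemma dz_tensor F G G' : (forall x, is_derive x (1 : R) G (G' x)) ->
  dz (fun q => F q.1 * G q.2) = (fun q => F q.1 * G' q.2).
Proof.
move=> dG; apply/funext => p; rewrite /dz.
by have [] := @is_derive_tensor2 F G p _ (dG p.2).
Qed.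

(** Both partial derivatives are again tensor products, so induction on [k] applies to them. *)
Lemma Ck_tensor k F G : Ck1 k F -> Ck1 k G -> Ck k (fun p => F p.1 * G p.2).
Proof.
have ct F0 G0 : continuous F0 -> continuous G0 ->
    continuous (fun p : R * R => F0 p.1 * G0 p.2).
  move=> cF cG p; apply: cvgM.
    by apply: (@continuous_comp _ _ _ fst F0); [exact: cvg_fst|exact: cF].
  by apply: (@continuous_comp _ _ _ snd G0); [exact: cvg_snd|exact: cG].
elim: k F G => [|k IH] F G; first exact: ct.
move=> cF cG; have [F' dF cF'] := cF; have [G' dG cG'] := cG; split.
- exact: ct (Ck1_continuous cF) (Ck1_continuous cG).
- by move=> p; have [] := @is_derive_tensor1 F G p _ (dF p.1).
- by move=> p; have [] := @is_derive_tensor2 F G p _ (dG p.2).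
- by rewrite (dr_tensor G dF); apply: IH => //; exact: Ck1W.
- by rewrite (dz_tensor F dG); apply: IH => //; exact: Ck1W.
Qed.

End TensorProduct.

(** * A one-variable bump supported in [[1, 2]] *)

Section Bump.
Variable R : realType.
Implicit Types (P Q : {poly R}) (x : R).

(* The affine maps carry explicit coefficients to match [Ck1_affine]. *)
Definition flat_bump P Q x : R := flat P (1 * x + -1) * flat Q (-1 * x + 2).

Lemma Ck1_bump k P Q : Ck1 k (flat_bump P Q).
Proof. by apply: Ck1M; apply: Ck1_affine; exact: Ck1_flat. Qed.

Lemma bump_out P Q x : ~~ (1 <= x <= 2) -> flat_bump P Q x = 0.
Proof.
rewrite negb_and -!ltNge /flat_bump => /orP[x1|x2].
  by rewrite flat_le0 ?mul0r//; lra.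
by rewrite (@flat_le0 _ Q) ?mulr0//; lra.
Qed.

Lemma bump_bound P Q : exists2 M, 0 <= M & forall x, `|flat_bump P Q x| <= M.
Proof.
have [K K0 PK] := flat_bound P; have [L L0 QL] := flat_bound Q.
exists (K * L) => [|x]; first exact: mulr_ge0.
by rewrite normrM ler_pM.
Qed.

Lemma bump1_lower : exists2 c : R, 0 < c &
  forall x, 4 / 3 <= x <= 5 / 3 -> c <= flat_bump 1 1 x.
Proof.
(* On the middle third of [[1, 2]], both [x - 1] and [2 - x] are at least [1/3], so each factor is
   at least [exp(-3)]. *)
exists (expR (- 3) * expR (- 3)); first by rewrite mulr_gt0 ?expR_gt0.
have e y : 3^-1 <= y -> expR (- 3) <= flat 1 y.
  move=> y3; have y0 : 0 < y by apply: lt_le_trans y3; rewrite invr_gt0.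
  rewrite /flat y0 hornerC mul1r ler_expR lerN2.
  by rewrite -[leRHS]invrK lef_pV2// ?posrE// ?invr_gt0.
by move=> x /andP[x1 x2]; rewrite ler_pM ?expR_ge0//; apply: e; lra.
Qed.

(** The derivative is a combination of two functions [flat_bump], so its continuity, support and
    bound are inherited from them. *)
Lemma is_derive_bump1 : exists2 u' : R -> R,
  (forall x, is_derive x (1 : R) (flat_bump 1 1) (u' x)) &
  [/\ continuous u', forall x, ~~ (1 <= x <= 2) -> u' x = 0 &
      exists2 M, 0 <= M & forall x, `|u' x| <= M].
Proof.
pose Q : {poly R} := (1 - 1^`()) * 'X ^+ 2.
exists (fun x => flat_bump Q 1 x + (- 1) * flat_bump 1 Q x).
  move=> x.
  have d1 : is_derive x (1 : R) (fun x => flat 1 (1 * x + -1))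
      (flat Q (1 * x + -1) * 1).
    apply: (@is_derive1_comp _ (flat 1) (fun x => 1 * x + -1)).
    - exact: is_derive_flat.
    - exact: is_derive_affine.
  have d2 : is_derive x (1 : R) (fun x => flat 1 (-1 * x + 2))
      (flat Q (-1 * x + 2) * -1).
    apply: (@is_derive1_comp _ (flat 1) (fun x => -1 * x + 2)).
    - exact: is_derive_flat.
    - exact: is_derive_affine.
  have d := is_deriveM d1 d2; apply: is_derive_eq d _.
  by rewrite /GRing.scale/= /flat_bump; ring.
split.
- apply: (@Ck1_continuous _ 0); apply: Ck1D; first exact: Ck1_bump.
  by apply: Ck1M; [exact: (Ck1_cst 0 (-1))|exact: Ck1_bump].
- by move=> x x12; rewrite !bump_out// mulr0 addr0.
- have [K K0 QK] := bump_bound Q 1; have [L L0 QL] := bump_bound 1 Q.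
  exists (K + L) => [|x]; first exact: addr_ge0.
  by rewrite mulN1r (le_trans (ler_normB _ _))// lerD.
Qed.

End Bump.

(** * Bounds for half-plane integrals by means of squares *)

Section SquareIntegrals.
Variable R : realType.
Implicit Types (f : R * R -> R) (F G : R -> R) (a b K : R).

Let mu2 := (@lebesgue_measure R \x @lebesgue_measure R)%E.
Let sq a b : set (R * R) := `[a, b]%classic `*` `[a, b]%classic.

Lemma measurable_half_plane : measurable (@half_plane R).
Proof.
have -> : @half_plane R = `]0, +oo[%classic `*` setT.
  by apply/seteqP; split => p; rewrite /half_plane /= in_itv/= andbT // => -[].
exact: measurableX.
Qed.

Let measurable_sq a b : measurable (sq a b).
Proof. exact: measurableX. Qed.

Let mu2_sq a b : a < b -> mu2 (sq a b) = ((b - a) ^+ 2)%:E.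
Proof.
move=> ab; rewrite /mu2 /sq product_measure1E//.
have mE : lebesgue_measure (`[a, b]%classic : set R) = (b - a)%:E.
  by rewrite lebesgue_measure_itv/= lte_fin ab EFinB.
by rewrite expr2 EFinM -mE.
Qed.

Let sq_half_plane a b : 0 < a -> sq a b `<=` @half_plane R.
Proof.
move=> a0 p [/= + _]; rewrite in_itv/= => /andP[ap _].
exact: lt_le_trans ap.
Qed.

(** Since [f] vanishes off the square, which lies in the half-plane because [a > 0], the integral is
    at most [K] times the area. *)
Lemma le_integral_square f a b K : 0 < a -> a < b -> 0 <= K ->
  measurable_fun setT f -> (forall p, 0 <= f p) ->
  (forall p, (~~ (a <= p.1 <= b) || ~~ (a <= p.2 <= b)) -> f p = 0) ->
  (forall p, a <= p.1 <= b -> f p <= K) ->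
  (\int[mu2]_(p in @half_plane R) (f p)%:E <= (K * (b - a) ^+ 2)%:E)%E.
Proof.
move=> a0 ab K0 mf f0 fout fK.
have -> : (\int[mu2]_(p in @half_plane R) (f p)%:E =
           \int[mu2]_(p in sq a b) (f p)%:E)%E.
  rewrite integral_mkcond [RHS]integral_mkcond; apply: eq_integral => p _.
  rewrite /patch; case: ifPn => [|/negP] ph; case: ifPn => [|/negP] ps //.
    rewrite fout// -negb_and; apply/negP => /andP[p1 p2]; apply: ps.
    by rewrite inE; split; rewrite /= in_itv.
  by exfalso; apply: ph; move: ps; rewrite !inE; exact: sq_half_plane.
rewrite EFinM -(mu2_sq ab) -integral_cst; last exact: measurable_sq.
apply: ge0_le_integral; first exact: measurable_sq.
- by move=> p _; rewrite lee_fin.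
- by apply/measurable_EFinP; exact: measurable_funTS.
- exact: measurable_cst.
- by move=> p [/=]; rewrite in_itv/= => p1 _; rewrite lee_fin fK.
Qed.

Lemma ge_integral_square f a b K : 0 < a -> a < b -> 0 <= K ->
  measurable_fun setT f -> (forall p, 0 <= f p) ->
  (forall p, a <= p.1 <= b -> a <= p.2 <= b -> K <= f p) ->
  ((K * (b - a) ^+ 2)%:E <= \int[mu2]_(p in @half_plane R) (f p)%:E)%E.
Proof.
move=> a0 ab K0 mf f0 fK.
have mfE D : measurable_fun D (fun p => (f p)%:E).
  by apply/measurable_EFinP; exact: measurable_funTS.
apply: (@le_trans _ _ (\int[mu2]_(p in sq a b) (f p)%:E)%E); last first.
  apply: ge0_subset_integral.
  - exact: measurable_sq.
  - exact: measurable_half_plane.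
  - exact: mfE.
  - by move=> p _; rewrite lee_fin.
  - exact: sq_half_plane.
rewrite EFinM -(mu2_sq ab) -integral_cst; last exact: measurable_sq.
apply: ge0_le_integral; first exact: measurable_sq.
- by move=> p _; rewrite lee_fin.
- exact: measurable_cst.
- exact: mfE.
- by move=> p [/=]; rewrite !in_itv/= => p1 p2; rewrite lee_fin fK.
Qed.

Lemma measurable_tensor F G : continuous F -> continuous G ->
  measurable_fun setT (fun p : R * R => F p.1 * G p.2).
Proof.
move=> cF cG; apply: measurable_funM.
  by apply: measurableT_comp; first exact: continuous_measurable_fun.
by apply: measurableT_comp; first exact: continuous_measurable_fun.
Qed.

End SquareIntegrals.

(** * The rescaled bumps and the two sides of the inequality *)

Section ScaledBump.
Variables (R : realType) (u u' : R -> R).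
Hypothesis Ck1_u : forall k, Ck1 k u.
Hypothesis u_out : forall x, ~~ (1 <= x <= 2) -> u x = 0.
Hypothesis du : forall x, is_derive x (1 : R) u (u' x).
Hypothesis cu' : continuous u'.
Hypothesis u'_out : forall x, ~~ (1 <= x <= 2) -> u' x = 0.

Definition scaled (l : R) (p : R * R) : R := u (l * p.1) * u (l * p.2).

Let u_out_scaled (l x : R) : 0 < l -> ~~ (l^-1 <= x <= 2 * l^-1) ->
  ~~ (1 <= l * x <= 2).
Proof.
move=> l0; apply: contra => /andP[h1 h2]; apply/andP; split.
  by rewrite -[leLHS]mulr1 ler_pdivrMl.
by rewrite ler_pdivlMr// mulrC.
Qed.

Lemma test_function_scaled (l delta : R) : 0 < l -> 2 * l^-1 < delta ->
  test_function (axis_box delta) (scaled l).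
Proof.
move=> l0 ld.
have il0 : 0 < l^-1 by rewrite invr_gt0.
pose S : set (R * R) := `[l^-1, 2 * l^-1]%classic `*` `[l^-1, 2 * l^-1]%classic.
have cS : compact S by apply: compact_setX; exact: segment_compact.
have vS : supp (scaled l) `<=` S.
  (* As [S] is closed, it contains the support once it contains every point where the function is
     nonzero. *)
  have clS : closed S by apply: compact_closed => //; exact: norm_hausdorff.
  rewrite ((closure_id S).1 clS); apply: closureS => p /=.
  apply: contra_neqP => pS; rewrite /scaled.
  have [p1|p1] := boolP (l^-1 <= p.1 <= 2 * l^-1); last first.
    by rewrite u_out ?mul0r//; exact: u_out_scaled.
  rewrite [X in _ * X]u_out ?mulr0//; apply: u_out_scaled => //.
  by apply/negP => p2; apply: pS; split; rewrite /= in_itv.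
split.
- move=> k; have ul : Ck1 k (fun x => u (l * x)).
    have := Ck1_affine l 0 (Ck1_u k).
    by under eq_fun do rewrite addr0.
  exact: (Ck_tensor ul ul).
- by apply: (subclosed_compact _ cS vS); exact: closed_closure.
- move=> p /vS[/=]; rewrite !in_itv/= => /andP[a1 b1] /andP[a2 b2].
  by split; rewrite /= in_itv/=; apply/andP; split; lra.
Qed.

Let cu : continuous u := Ck1_continuous (Ck1_u 0).

Let c_scaled (F : R -> R) (l : R) : continuous F -> continuous (fun x => F (l * x)).
Proof.
move=> cF; have := @Ck1_affine _ 0 F l 0 cF.
by under eq_fun do rewrite addr0.
Qed.

Let d_scaled l x : is_derive x (1 : R) (fun x => u (l * x)) (u' (l * x) * l).
Proof.
apply: (@is_derive1_comp _ u (fun x => l * x)).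
have := is_derive_affine l 0 x.
by under eq_fun do rewrite addr0.
Qed.

(** Each derivative costs a factor [l], so the squared gradient is at most [2 M^4 l^2]. On the
    support [r^3 <= 8 / l^3], and the square has area [1 / l^2]. *)
Lemma grad_scaled_le (M : R) : (forall x, `|u x| <= M) ->
  (forall x, `|u' x| <= M) -> forall l : R, 0 < l ->
  (\int[@lebesgue_measure R \x @lebesgue_measure R]_(p in @half_plane R)
    ((dr (scaled l) p ^+ 2 + dz (scaled l) p ^+ 2) * (p.1 : R) ^+ 3)%:E
   <= (16 * M ^+ 4 * l^-1 ^+ 3)%:E)%E.
Proof.
move=> uM u'M l l0.
have il0 : 0 < l^-1 by rewrite invr_gt0.
have M0 : 0 <= M by apply: le_trans (uM 0).
have -> : dr (scaled l) = fun p => (u' (l * p.1) * l) * u (l * p.2).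
  exact: (dr_tensor (fun x => u (l * x)) (d_scaled l)).
have -> : dz (scaled l) = fun p => u (l * p.1) * (u' (l * p.2) * l).
  exact: (dz_tensor (fun x => u (l * x)) (d_scaled l)).
pose g (p : R * R) :=
  (u' (l * p.1) * l * u (l * p.2)) ^+ 2 + (u (l * p.1) * (u' (l * p.2) * l)) ^+ 2.
(* The absolute value makes [f] nonnegative on the whole plane, as [le_integral_square] requires,
   and changes nothing where [r > 0]. *)
pose f (p : R * R) := g p * `|p.1| ^+ 3.
have g_out p : ~~ (l^-1 <= p.1 <= 2 * l^-1) || ~~ (l^-1 <= p.2 <= 2 * l^-1) ->
    g p = 0.
  rewrite /g => /orP[] /(u_out_scaled l0) h.
    by rewrite (u_out h) (u'_out h) !mul0r expr0n addr0.
  by rewrite (u_out h) (u'_out h) !(mul0r, mulr0) expr0n addr0.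
have g0 p : 0 <= g p by rewrite addr_ge0 ?sqr_ge0.
have sq_le (x : R) (y : R) : `|x| <= y -> x ^+ 2 <= y ^+ 2.
  by move=> xy; rewrite -real_normK ?num_real// lerXn2r// nnegrE ?(le_trans _ xy).
have g_le p : g p <= 2 * M ^+ 4 * l ^+ 2.
  have -> : 2 * M ^+ 4 * l ^+ 2 = (M * l * M) ^+ 2 + (M * (M * l)) ^+ 2 by ring.
  rewrite lerD// sq_le// !normrM (gtr0_norm l0).
    by rewrite !(ler_pM, mulr_ge0)// ltW.
  by rewrite !(ler_pM, mulr_ge0)// ltW.
have cul := @c_scaled u l cu; have cu'l := @c_scaled u' l cu'.
have mf : measurable_fun setT f.
  apply: measurable_funM.
    apply: measurable_funD; apply: measurable_funX.
      apply: (@measurable_tensor _ (fun x => u' (l * x) * l) _ _ cul).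
      by move=> x; apply: cvgMl; exact: cu'l.
    apply: (@measurable_tensor _ _ (fun x => u' (l * x) * l) cul).
    by move=> x; apply: cvgMl; exact: cu'l.
  by apply: measurable_funX; apply: measurableT_comp => //; exact: measurable_fst.
have -> : (16 * M ^+ 4 * l^-1 ^+ 3) =
    16 * M ^+ 4 * l^-1 * (2 * l^-1 - l^-1) ^+ 2 by ring.
under eq_integral => p /[!inE] p0.
  have -> : (g p * p.1 ^+ 3)%:E = (f p)%:E by rewrite /f gtr0_norm.
  over.
apply: le_integral_square => //.
- by lra.
- by rewrite !mulr_ge0// ltW.
- by move=> p; rewrite mulr_ge0.
- by move=> p /g_out gp; rewrite /f gp mul0r.
- move=> p /andP[a1 b1].
  have -> : 16 * M ^+ 4 * l^-1 = 2 * M ^+ 4 * l ^+ 2 * (2 * l^-1) ^+ 3.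
    by field; rewrite gt_eqF.
  have p0 : 0 < p.1 by exact: lt_le_trans a1.
  rewrite ler_pM// gtr0_norm//.
  by rewrite lerXn2r// nnegrE ?mulr_ge0// ltW.
Qed.

Lemma L4_scaled_ge (beta c : R) : 0 < c ->
  (forall x, 4 / 3 <= x <= 5 / 3 -> c <= u x) ->
  exists2 A : R, 0 < A & forall l : R, 0 < l ->
  ((A * l `^ (- (beta + 2)))%:E <=
   \int[@lebesgue_measure R \x @lebesgue_measure R]_(p in @half_plane R)
      (`|scaled l p| ^+ 4 * (p.1 : R) `^ beta)%:E)%E.
Proof.
move=> c0 uc.
(* A lower bound for [s^beta] on [[1, 2]] valid for either sign of [beta], through
   [s^beta >= s^(-|beta|) >= 2^(-|beta|)]. *)
pose w : R := (2 `^ `|beta|)^-1.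
have w0 : 0 < w by rewrite invr_gt0 powR_gt0.
have wP s : 1 <= s <= 2 -> w <= s `^ beta.
  move=> /andP[s1 s2]; have s0 : 0 < s by exact: lt_le_trans s1.
  apply: (@le_trans _ _ (s `^ (- `|beta|))).
    rewrite powRN lef_pV2 ?posrE ?powR_gt0//.
    by rewrite ge0_ler_powR// nnegrE ltW.
  by rewrite ler_powR// lerNl -normrN ler_norm.
(* Where both rescaled coordinates lie in [[4/3, 5/3]], the function is at least [c^2], whence
   [c^8]. That square has area [1 / (9 l^2)]. *)
exists (c ^+ 8 * w / 9) => [|l l0].
  by rewrite divr_gt0// mulr_gt0// exprn_gt0.
have il0 : 0 < l^-1 by rewrite invr_gt0.
have -> : c ^+ 8 * w / 9 * l `^ (- (beta + 2)) =
    (c ^+ 2) ^+ 4 * (w * l `^ (- beta)) * (5 / 3 * l^-1 - 4 / 3 * l^-1) ^+ 2.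
  have -> : l `^ (- (beta + 2)) = l `^ (- beta) * l^-1 ^+ 2.
    rewrite opprD powRD; last by rewrite (gt_eqF l0) implybT.
    by rewrite powRN [l `^ (- 2)]powRN powR_mulrn ?ltW// exprVn.
  by field; rewrite gt_eqF.
apply: ge_integral_square.
- by rewrite mulr_gt0.
- by rewrite ltr_pM2r//; lra.
- by rewrite !mulr_ge0// ?powR_ge0 ?exprn_ge0// ltW.
- apply: measurable_funM.
    apply: measurable_funX; apply: measurableT_comp => //.
    by apply: (@measurable_tensor _ (fun x => u (l * x)) (fun x => u (l * x)));
      exact: c_scaled.
  apply: (measurableT_comp (measurable_powR beta)).
  exact: measurable_fst.
- by move=> p; rewrite mulr_ge0// powR_ge0.
- have sc x : 4 / 3 * l^-1 <= x <= 5 / 3 * l^-1 -> 4 / 3 <= l * x <= 5 / 3.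
    by rewrite !ler_pdivrMr// !ler_pdivlMr// (mulrC x).
  move=> p /sc p1 /sc p2.
  have lp0 : 0 < l * p.1 by move: p1 => /andP[p1 _]; apply: lt_le_trans p1; lra.
  have p0 : 0 < p.1 by rewrite -(pmulr_rgt0 _ l0).
  rewrite ler_pM//.
  + by rewrite !exprn_ge0// ltW.
  + by rewrite mulr_ge0// ?powR_ge0// ltW.
  + rewrite lerXn2r// ?nnegrE ?exprn_ge0//; first exact: ltW.
    by rewrite (le_trans _ (ler_norm _))// expr2 ler_pM ?uc// ltW.
  (* Here [r^beta] is written as [l^(-beta) (l r)^beta], with [l r] in [[1, 2]]. *)
  + rewrite powRN ler_pdivrMr ?powR_gt0// mulrC -powRM ?(ltW l0) ?(ltW p0)//.
    by apply: wP; move: p1 => /andP[p1 p1']; apply/andP; split; lra.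
Qed.

End ScaledBump.

(** * Contradiction for a large scaling parameter *)

Lemma no_weighted_ineq (R : realType) (alpha delta C : R) :
  alpha < 5 / 4 -> 0 < delta ->
  ~ (forall v : R * R -> R,
       test_function (axis_box delta) v -> weighted_ineq alpha C v).
Proof.
move=> a54 delta0 H.
pose u : R -> R := flat_bump 1 1.
have uS k : Ck1 k u by exact: Ck1_bump.
have u_out x : ~~ (1 <= x <= 2) -> u x = 0 by exact: bump_out.
have [c c0 uc] := bump1_lower R.
have [u' du [cu' u'_out [M' M'0 u'M']]] := is_derive_bump1 R.
have [M0 M00 uM0] := @bump_bound R 1 1.
pose M := M0 + M'.
have uM x : `|u x| <= M by rewrite (le_trans (uM0 x))// lerDl.
have u'M x : `|u' x| <= M by rewrite (le_trans (u'M' x))// lerDr.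
have M_ge0 : 0 <= M by exact: addr_ge0.
have [A A0 HA] := L4_scaled_ge uS (4 * alpha - 1) c0 uc.
pose B : R := 16 * M ^+ 4.
have B0 : 0 <= B by rewrite mulr_ge0// exprn_ge0.
(* The fourth power of the inequality reads [A l^(gamma - 6) <= |C|^4 B^2 l^(-6)], that is,
   [l^gamma <= D]. *)
pose D : R := `|C| ^+ 4 * B ^+ 2 / A.
have D0 : 0 <= D by rewrite divr_ge0 ?mulr_ge0 ?exprn_ge0// ltW.
pose gamma : R := 5 - 4 * alpha.
have gamma0 : 0 < gamma by rewrite /gamma; lra.
have D1 : 0 < D + 1 by rewrite ltr_wpDl.
(* The first summand forces [l^gamma >= D + 1]; the other forces [2 / l < delta], placing the
   support in the box. *)
pose l : R := (D + 1) `^ gamma^-1 + (2 / delta + 1).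
have l0 : 0 < l by rewrite addr_gt0 ?powR_gt0// addr_gt0// divr_gt0.
have il0 : 0 < l^-1 by rewrite invr_gt0.
have ld : 2 * l^-1 < delta.
  rewrite ltr_pdivrMr// mulrC -ltr_pdivrMr// /l.
  have := powR_ge0 (D + 1) gamma^-1; lra.
have lD : D + 1 <= l `^ gamma.
  have -> : D + 1 = ((D + 1) `^ gamma^-1) `^ gamma.
    by rewrite -powRrM mulVf ?gt_eqF// powRr1// ltW.
  rewrite ge0_ler_powR ?nnegrE ?powR_ge0 ?(ltW gamma0) ?(ltW l0)//.
  by rewrite /l lerDl addr_ge0// divr_ge0// ltW.
have := H _ (test_function_scaled uS u_out l0 ld).
rewrite /weighted_ineq /weighted_L4 /weighted_grad_L2 => ineq.
have gle := grad_scaled_le uS u_out du cu' u'_out uM u'M l0.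
set J := (\int[_]_(p in _) _)%E in gle.
have J0 : (0 <= J)%E.
  apply: integral_ge0 => p p0; rewrite lee_fin mulr_ge0 ?addr_ge0 ?sqr_ge0//.
  by rewrite exprn_ge0// ltW.
have Jle : (J `^ 2^-1 <= ((B * l^-1 ^+ 3) `^ 2^-1)%:E)%E.
  rewrite -poweR_EFin; apply: gt0_ler_poweR => //.
  - by rewrite in_itv/= J0 leey.
  - by rewrite in_itv/= leey andbT lee_fin mulr_ge0// exprn_ge0// ltW.
have := HA l l0; set I := (\int[_]_(p in _) _)%E => Ige.
set a := A * _ in Ige.
have a0 : 0 < a by rewrite mulr_gt0// powR_gt0.
have I0 : (0 <= I)%E by apply: le_trans Ige; rewrite lee_fin ltW.
have Ile : ((a `^ 4^-1)%:E <= I `^ 4^-1)%E.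
  rewrite -poweR_EFin; apply: gt0_ler_poweR => //.
  - by rewrite in_itv/= leey andbT lee_fin ltW.
  - by rewrite in_itv/= I0 leey.
(* [C] may be negative, so it is replaced by its absolute value before the gradient bound is
   multiplied by it. *)
have : ((a `^ 4^-1)%:E <= `|C|%:E * ((B * l^-1 ^+ 3) `^ 2^-1)%:E)%E.
  apply: (le_trans Ile); apply: (le_trans ineq).
  apply: (@le_trans _ _ (`|C|%:E * J `^ 2^-1)%E).
    by apply: lee_wpmul2r; rewrite ?poweR_ge0// lee_fin ler_norm.
  by apply: lee_wpmul2l; rewrite ?lee_fin.
rewrite -EFinM lee_fin => ineqR.
(* Raising both nonnegative sides to the fourth power removes the roots. *)
have {ineqR} : a <= `|C| ^+ 4 * (B * l^-1 ^+ 3) ^+ 2.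
  have aE : a = (a `^ 4^-1) ^+ 4.
    by rewrite -powR_mulrn ?powR_ge0// -powRrM mulVf// powRr1// ltW.
  have bE (b : R) : 0 <= b -> b ^+ 2 = (b `^ 2^-1) ^+ 4.
    move=> b0; rewrite -[4%N]/(2 * 2)%N exprM; congr (_ ^+ 2).
    by rewrite -powR_mulrn ?powR_ge0// -powRrM mulVf// powRr1.
  rewrite aE bE; last by rewrite mulr_ge0// exprn_ge0// ltW.
  by rewrite -exprMn lerXn2r// nnegrE ?mulr_ge0 ?powR_ge0.
have -> : a = A * (l `^ gamma * l^-1 ^+ 6).
  rewrite /a; congr (A * _).
  have -> : - (4 * alpha - 1 + 2) = gamma - 6 by rewrite /gamma; ring.
  rewrite powRD; last by rewrite (gt_eqF l0) implybT.
  by rewrite [l `^ (- 6)]powRN powR_mulrn ?ltW// exprVn.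
apply/negP; rewrite -ltNge.
have -> : `|C| ^+ 4 * (B * l^-1 ^+ 3) ^+ 2 = A * (D * l^-1 ^+ 6).
  by rewrite /D; field; rewrite !gt_eqF.
rewrite ltr_pM2l// ltr_pM2r ?exprn_gt0//.
by apply: lt_le_trans lD; rewrite ltrDl.
Qed.

(** Scale-independence is expressed by one [C] serving all boxes of size at most [delta0]. *)
Theorem proposition11p1 (R : realType) :
  (forall alpha delta : R, alpha < 5 / 4 -> 0 < delta ->
     ~ exists C : R, forall v : R * R -> R,
         test_function (axis_box delta) v -> weighted_ineq alpha C v)
  /\
  (forall alpha delta0 : R, 3 / 4 < alpha < 1 -> 0 < delta0 ->
     ~ exists C : R, forall delta : R, 0 < delta <= delta0 ->
         forall v : R * R -> R,
           test_function (axis_box delta) v -> weighted_ineq alpha C v).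
Proof.
split=> [alpha delta a54 d0 [C]|alpha delta0 /andP[_ a1] d0 [C HC]].
  exact: no_weighted_ineq.
(* A constant uniform over these boxes serves in particular the largest one, [delta = delta0]. *)
apply: (@no_weighted_ineq R alpha delta0 C) => //; first lra.
by apply: HC; rewrite d0 lexx.
Qed.
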